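(* Let $r\ge 2$ and $t\ge 2$, and let $H_1, H_2, \dots, H_t$ be connected $r$-uniform hypergraphs such that $gr(H_1, H_2, \dots, H_{t-1};r)\ge s(H_t)$. Then $$gr(H_1, H_2, \dots, H_t;r)\ge (\chi(H_t)-1)\left(gr(H_1, H_2, \dots, H_{t-1};r)-1\right)+s(H_t).$$
   Context: An $r$-uniform hypergraph $H=(V,E)$ consists of a nonempty finite set $V$ of vertices and a set $E$ of hyperedges, which are (distinct) $r$-element subsets of $V$. $K_n^{(r)}$ denotes the complete $r$-uniform hypergraph of order $n$ (every $r$-element subset of the vertex set is a hyperedge; no hyperedges if $n<r$). The (weak) chromatic number $\chi(H)$ of an $r$-uniform hypergraph $H$ is the minimum number of colors needed to color the vertices of $H$ such that no hyperedge is monochromatic; such a vertex coloring is called proper. The number $s(H)$ (called the chromatic index in the paper) is the smallest cardinality of a color class among all proper vertex colorings of $H$ using $\chi(H)$ colors. A $t$-coloring of an $r$-uniform hypergraph $H$ is a function $E(H)\to\{1,2,\dots,t\}$ on hyperedges. A hypergraph is rainbow under a coloring if all of its hyperedges receive pairwise distinct colors. A Gallai $t$-coloring of $K_n^{(r)}$ is a $t$-coloring that contains no rainbow subhypergraph isomorphic to $K_{r+1}^{(r)}$. For $r$-uniform hypergraphs $H_1,\dots,H_t$, the Gallai-Ramsey number $gr(H_1,\dots,H_t;r)$ is the least natural number $p$ such that every Gallai $t$-coloring of $K_p^{(r)}$ contains, for some $i\in\{1,\dots,t\}$, a (not necessarily induced) subhypergraph isomorphic to $H_i$ all of whose hyperedges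 have color $i$. *)

(* Defs.v *)
From mathcomp Require Import all_boot all_order.

Set Implicit Arguments.
Unset Strict Implicit.
Unset Printing Implicit Defensive.

(* The vertex set may be empty here, so that the complete hypergraph of order 0
   makes sense; nonemptiness is assumed explicitly where it is needed. *)
Record hypergraph (r : nat) := Hypergraph {
  vertex :> finType;
  edges : {set {set vertex}};
  edges_uniform : forall e, e \in edges -> #|e| = r
}.

Definition edge r (H : hypergraph r) := {e : {set H} | e \in edges H}.

Fact complete_uniform r n (e : {set 'I_n}) :
  e \in [set e : {set 'I_n} | #|e| == r] -> #|e| = r.
Proof. by rewrite inE => /eqP. Qed.

Definition complete_hypergraph r n : hypergraph r :=
  Hypergraph (@complete_uniform r n).

Section Connectivity.
Variables (r : nat) (H : hypergraph r).

Definition adjacent : rel H :=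
  [rel u v | [exists e in edges H, (u \in e) && (v \in e)]].

Definition connected := [forall u, forall v, connect adjacent u v].

End Connectivity.

Section VertexColorings.
Variables (r : nat) (H : hypergraph r).

Definition proper k (c : {ffun H -> 'I_k}) :=
  [forall e in edges H, ~~ [exists j, [forall v in e, c v == j]]].

Definition colorable k := [exists c : {ffun H -> 'I_k}, proper c].

(* The default #|H| of the minimum is attained: if 1 < r, any injective
   coloring is proper. See chromatic_numberP. *)
Definition chromatic_number : nat :=
  \big[Order.min/#|H|]_(k < #|H|.+1 | colorable k) (k : nat).

(* The default #|H| is an upper bound of all the terms. See min_classP. *)
Definition min_class : nat :=
  \big[Order.min/#|H|]_(c : {ffun H -> 'I_chromatic_number} | proper c)
    \big[Order.min/#|H|]_(j < chromatic_number) #|c @^-1: [set j]|.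

End VertexColorings.

Section Copies.
Variables (r : nat) (F G : hypergraph r).

Definition embedding (f : {ffun F -> G}) :=
  injectiveb f && [forall e in edges F, f @: e \in edges G].

Definition copy_edges (f : {ffun F -> G}) : {set edge G} :=
  [set e | [exists e0 in edges F, val e == f @: e0]].

End Copies.

Section EdgeColorings.
Variables (r t : nat) (G : hypergraph r).

Definition edge_coloring := {ffun edge G -> 'I_t}.

Definition rainbow (c : edge_coloring) (S : {set edge G}) :=
  [forall e1 in S, forall e2 in S, (c e1 == c e2) ==> (e1 == e2)].

Definition monochromatic (c : edge_coloring) (i : 'I_t) (S : {set edge G}) :=
  [forall e in S, c e == i].

Definition gallai (c : edge_coloring) :=
  ~~ [exists f : {ffun complete_hypergraph r r.+1 -> G},
        embedding f && rainbow c (copy_edges f)].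

End EdgeColorings.

Definition gallai_arrow r t (H : 'I_t -> hypergraph r) (p : nat) :=
  [forall c : edge_coloring t (complete_hypergraph r p),
     gallai c ==>
       [exists i, exists f : {ffun H i -> complete_hypergraph r p},
          embedding f && monochromatic c i (copy_edges f)]].

(* Existence of Gallai-Ramsey numbers, from Ramsey's theorem for uniform
   hypergraphs. *)
Section Ramsey.

Fixpoint prehomogeneous (T : finType) t r (c : {set T} -> 'I_t) (g : T -> 'I_t)
    (s : seq T) : Prop :=
  if s is x :: s' then
    (forall e : {set T}, e \subset s' -> #|e| = r -> c (x |: e) = g x)
    /\ prehomogeneous r c g s'
  else True.

Definition ramsey_prop r t :=
  forall N, exists p, forall (T : finType) (A : {set T}) (c : {set T} -> 'I_t),
    p <= #|A| -> exists (B : {set T}) (i : 'I_t),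
      [/\ B \subset A, N <= #|B|
        & forall e : {set T}, e \subset B -> #|e| = r -> c e = i].

Lemma prehomogeneous_sub (T : finType) t r (c : {set T} -> 'I_t) g s s' :
  subseq s' s -> prehomogeneous r c g s -> prehomogeneous r c g s'.
Proof.
elim: s s' => [|x s IHs] [|y s'] //= sub [hx hs].
move: sub; case: eqP => [->|_] sub; last exact: IHs sub hs.
split; last exact: IHs.
move=> e es' er; apply: hx => //; apply: subset_trans es' _.
by apply/subsetP => z; apply: (mem_subseq sub).
Qed.

Lemma prehomogeneous_eq (T : finType) t r (c : {set T} -> 'I_t) g g' s :
  {in s, g =1 g'} -> prehomogeneous r c g s -> prehomogeneous r c g' s.
Proof.
elim: s => //= x s IHs eqg [hx hs]; split; last first.
  by apply: IHs hs => y ys; apply: eqg; rewrite inE ys orbT.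
by move=> e es er; rewrite -(eqg x) ?inE ?eqxx // hx.
Qed.

Lemma prehomogeneous_exists r t (i0 : 'I_t) m : ramsey_prop r t ->
  exists p, forall (T : finType) (A : {set T}) (c : {set T} -> 'I_t),
    p <= #|A| -> exists (s : seq T) (g : T -> 'I_t),
      [/\ uniq s, size s = m, {subset s <= A} & prehomogeneous r c g s].
Proof.
move=> R; elim: m => [|m [q Hq]].
  by exists 0 => T A c _; exists [::], (fun=> i0); split.
have [p Hp] := R q; exists p.+1 => T A c leA.
have [x xA] : exists x, x \in A by apply/card_gt0P; apply: leq_ltn_trans leA.
have leA' : p <= #|A :\ x| by move: leA; rewrite (cardsD1 x) xA.
have [B [i [BA leB Bi]]] := Hp T _ (fun e => c (x |: e)) leA'.
have [s [g [us szs sB hs]]] := Hq T B c leB.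
have xs : x \notin s.
  by apply/negP => /sB /(subsetP BA); rewrite !inE eqxx.
exists (x :: s), (fun y => if y == x then i else g y); split=> /=.
- by rewrite xs.
- by rewrite szs.
- move=> y; rewrite inE => /orP [/eqP -> //|/sB /(subsetP BA)].
  by rewrite inE => /andP [].
rewrite eqxx; split.
  move=> e es er; apply: Bi => //; apply/subsetP => y /(subsetP es).
  exact: sB.
apply: prehomogeneous_eq hs => y ys; case: eqP => // yx.
by rewrite -yx ys in xs.
Qed.

Lemma ramsey r t : 0 < t -> ramsey_prop r t.
Proof.
case: t => // t _; elim: r => [|r IHr] N.
  exists N => T A c leA; exists A, (c set0); split=> // e _ /eqP.
  by rewrite cards_eq0 => /eqP ->.
have [p Hp] := prehomogeneous_exists ord0 (t.+1 * N) IHr.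
exists p => T A c leA; have [s [g [us szs sA hs]]] := Hp T A c leA.
have [i lei] : exists i, N <= count (fun x => g x == i) s.
  apply/existsP; rewrite -[X in is_true X]negbK negb_exists.
  apply/negP => /forallP lt; case: N Hp lt szs => [|N] _ lt szs.
    by have := lt ord0; rewrite leq0n.
  have : size s <= t.+1 * N.
    rewrite -sum1_size (partition_big g predT) //=.
    rewrite -[X in X * _](card_ord t.+1) -sum_nat_const; apply: leq_sum => i _.
    by rewrite sum1_count; have := lt i; rewrite -ltnNge ltnS.
  by rewrite szs leq_mul2l /= ltnn.
pose s' := [seq x <- s | g x == i].
have us' : uniq s' by rewrite filter_uniq.
have hs' : prehomogeneous r c g s' by apply: prehomogeneous_sub hs; apply: filter_subseq.
have gs' : {in s', forall x, g x = i} by move=> x; rewrite mem_filter => /andP [/eqP].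
exists [set x in s'], i; split.
- by apply/subsetP => x; rewrite inE mem_filter => /andP [_ /sA].
- by rewrite cardsE (card_uniqP us') size_filter.
elim: s' us' hs' gs' => [|x s' IHs] /= us' hs' gs' e es er.
  have e0 : e = set0.
    by apply/setP => y; rewrite inE; apply/negP => /(subsetP es); rewrite inE.
  by rewrite e0 cards0 in er.
case/andP: us' => xs' us'; case: hs' => hx hs'.
have [xe|xe] := boolP (x \in e).
  rewrite -(setD1K xe) hx; first by apply: gs'; rewrite inE eqxx.
    apply/subsetP => y; rewrite !inE => /andP [yx /(subsetP es)].
    by rewrite !inE (negbTE yx).
  by move: er; rewrite (cardsD1 x) xe => - [].
apply: IHs => //.
  by move=> y ys; apply: gs'; rewrite inE ys orbT.
apply/subsetP => y ye; have := subsetP es y ye; rewrite !inE => /orP [/eqP yx|//].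
by rewrite -yx ye in xe.
Qed.

End Ramsey.

Lemma gallai_arrow_exists r t (H : 'I_t -> hypergraph r) :
  exists p, gallai_arrow H p.
Proof.
case: t H => [|t] H.
  have fullP : [set: 'I_r] \in edges (complete_hypergraph r r).
    by rewrite inE cardsT card_ord.
  pose e : edge (complete_hypergraph r r) := exist _ [set: 'I_r] fullP.
  exists r; apply/forallP => c; case: (c e) => k.
  by rewrite ltn0.
have [p Hp] := ramsey r (ltn0Sn t) (\max_i #|H i|).
exists p; apply/forallP => c; apply/implyP => _.
pose c' e : 'I_t.+1 := if insub e is Some e' then c e' else ord0.
have [|B [i [_ leB Bi]]] := Hp 'I_p setT c'; first by rewrite cardsT card_ord.
have leHB : #|H i| <= #|B| := leq_trans (leq_bigmax i) leB.
pose f : {ffun H i -> complete_hypergraph r p} :=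
  [ffun v => enum_val (widen_ord leHB (enum_rank v))].
have fI : injective f.
  move=> u v; rewrite !ffunE => /enum_val_inj /(congr1 val) /= /val_inj.
  exact: enum_rank_inj.
have fB (e : {set H i}) : f @: e \subset B.
  by apply/subsetP => x /imsetP [v _ ->]; rewrite ffunE enum_valP.
apply/existsP; exists i; apply/existsP; exists f; apply/andP; split.
  apply/andP; split; first exact/injectiveP.
  apply/forall_inP => e He; rewrite inE card_imset //.
  by rewrite (edges_uniform He).
apply/forall_inP => e; rewrite inE => /exists_inP [e0 He0 /eqP ee0].
have := Bi (val e); rewrite /c' valK => -> //; first by rewrite ee0.
exact: edges_uniform (valP e).
Qed.

Definition gallai_ramsey r t (H : 'I_t -> hypergraph r) : nat :=
  ex_minn (gallai_arrow_exists H).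

Section Specifications.
Variables (r : nat) (H : hypergraph r).
Hypothesis r_gt1 : 1 < r.

Lemma colorable_card : colorable H #|H|.
Proof.
apply/existsP; exists [ffun v => enum_rank v]; apply/forall_inP => e He.
apply/existsP => - [j /forall_inP ej].
have : #|e| <= 1.
  apply/card_le1P => x xe y; rewrite inE; apply/idP/eqP => [ye|-> //].
  have /eqP := ej x xe; have /eqP := ej y ye; rewrite !ffunE => <-.
  by move/enum_rank_inj.
by rewrite (edges_uniform He) leqNgt r_gt1.
Qed.

Lemma chromatic_numberP :
  colorable H (chromatic_number H)
  /\ forall k, colorable H k -> chromatic_number H <= k.
Proof.
split.
  rewrite /chromatic_number; elim/big_ind: _ => //; first exact: colorable_card.
  by move=> x y cx cy; rewrite Order.POrderTheory.minEle; case: ifP.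
move=> k ck; have [lek|/ltnW ltk] := leqP k #|H|.
  rewrite -Order.NatOrder.leEnat.
  exact: (Order.TotalTheory.bigmin_le_cond #|H|
            (j := Ordinal (lek : k < #|H|.+1)) (fun k : 'I__ => k : nat)).
by apply: leq_trans ltk; rewrite -Order.NatOrder.leEnat; apply: Order.TotalTheory.bigmin_le_id.
Qed.

Hypothesis H_gt0 : 0 < #|H|.

Lemma min_classP :
  (exists (c : {ffun H -> 'I_(chromatic_number H)}) j,
     proper c /\ #|c @^-1: [set j]| = min_class H)
  /\ forall (c : {ffun H -> 'I_(chromatic_number H)}) j,
     proper c -> min_class H <= #|c @^-1: [set j]|.
Proof.
set k := chromatic_number H.
have min_le (c : {ffun H -> 'I_k}) j : proper c -> min_class H <= #|c @^-1: [set j]|.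
  move=> pc; pose m (c : {ffun H -> 'I_k}) : nat :=
    \big[Order.min/#|H|]_(j < k) #|c @^-1: [set j]|.
  apply: (@leq_trans (m c)); rewrite -Order.NatOrder.leEnat; first exact: (Order.TotalTheory.bigmin_le_cond _ m pc).
  exact: (Order.TotalTheory.bigmin_le _ j (fun j => #|c @^-1: [set j]|)).
split=> //; have [/existsP [c0 pc0] _] := chromatic_numberP.
have /card_gt0P [v _] := H_gt0.
pose attained m := m = #|H| \/ exists (c : {ffun H -> 'I_k}) j,
  proper c /\ #|c @^-1: [set j]| = m.
have min_attained m1 m2 : attained m1 -> attained m2 -> attained (Order.min m1 m2).
  by rewrite Order.POrderTheory.minEle; case: ifP.
have [eqH|//] : attained (min_class H).
  rewrite /min_class -/k; elim/big_ind: _ => //; first by left.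
  move=> c pc; elim/big_ind: _ => //; first by left.
  by move=> j _; right; exists c, j.
exists c0, (c0 v); split=> //; apply/eqP; rewrite eqn_leq min_le // andbT.
by rewrite eqH max_card.
Qed.

End Specifications.

(* Main.v *)
Require Import Defs.
From mathcomp Require Import all_boot all_order.

(** The bound comes from a block construction.  Let g be the Gallai-Ramsey
    number of the family without its last member F, and let k and s be the
    chromatic number and the least color class size of F.  By minimality of g
    there is a Gallai coloring c of the complete hypergraph of order g - 1
    without a monochromatic copy of any member but F.  Cut fewer than
    (k - 1) (g - 1) + s vertices into k blocks, of which the first k - 1 have
    at most g - 1 vertices, and the last one at most s - 1 <= g - 1.  Color each
    block by a copy of c, and give the new color to every hyperedge that meets
    two blocks.

    - The result is a Gallai coloring ([gallai_block_coloring]): a set of r + 1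
      vertices inside one block is not rainbow because c is Gallai, and a set of
      r + 1 >= 3 vertices that meets two blocks has two hyperedges that also
      do, which both have the new color.
    - A connected hypergraph that is monochromatic in an old color stays inside
      one block ([connected_one_block]), so it is a copy for c, which
      is impossible ([block_coloring_old]).
    - In a copy of F in the new color every hyperedge meets two blocks, so the
      blocks are the classes of a proper k-coloring of F
      ([block_coloring_new]); the last class has fewer than s elements,
      against the definition of s.  Here s > 0 matters ([min_class_gt0]): if
      s were 0, the last block could be empty without any contradiction. *)

Set Implicit Arguments.
Unset Strict Implicit.
Unset Printing Implicit Defensive.

(** * Colors of images of hyperedges *)

Section SetColor.
Variables (r t : nat) (F G : hypergraph r) (c : edge_coloring t G).

(** Reading an edge coloring on arbitrary vertex sets, so that images [f @: e]
    need not be packed with a proof that they are hyperedges. *)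
Definition set_color (A : {set G}) : option 'I_t := omap c (insub A).

Lemma set_color_val (e : edge G) : set_color (val e) = Some (c e).
Proof. by rewrite /set_color valK. Qed.

Variable f : {ffun F -> G}.
Hypothesis f_emb : embedding f.

Lemma embedding_inj : injective f.
Proof. by case/andP: f_emb => /injectiveP. Qed.

Lemma embedding_edge e : e \in edges F -> f @: e \in edges G.
Proof. by case/andP: f_emb => _ /forall_inP; apply. Qed.

Lemma monochromaticP (i : 'I_t) :
  reflect (forall e, e \in edges F -> set_color (f @: e) = Some i)
          (monochromatic c i (copy_edges f)).
Proof.
apply: (iffP forall_inP) => [mono e Fe|mono e].
  pose fe : edge G := exist _ (f @: e) (embedding_edge Fe).
  rewrite -[f @: e]/(val fe) set_color_val; congr Some; apply/eqP/mono.
  by rewrite inE; apply/exists_inP; exists e.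
rewrite inE => /exists_inP [e0 /mono + /eqP ee0].
by rewrite -ee0 set_color_val => -[->].
Qed.

Lemma rainbowP :
  reflect (forall e1 e2, e1 \in edges F -> e2 \in edges F ->
             set_color (f @: e1) = set_color (f @: e2) -> e1 = e2)
          (rainbow c (copy_edges f)).
Proof.
apply: (iffP forall_inP) => [rb e1 e2 Fe1 Fe2|rb e1].
  pose fe1 : edge G := exist _ (f @: e1) (embedding_edge Fe1).
  pose fe2 : edge G := exist _ (f @: e2) (embedding_edge Fe2).
  rewrite -[f @: e1]/(val fe1) -[f @: e2]/(val fe2) !set_color_val => -[cE].
  have in1 : fe1 \in copy_edges f by rewrite inE; apply/exists_inP; exists e1.
  have in2 : fe2 \in copy_edges f by rewrite inE; apply/exists_inP; exists e2.
  have /forall_inP /(_ _ in2) := rb _ in1; rewrite cE eqxx => /eqP /(congr1 val) /=.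
  by apply: imset_inj; apply: embedding_inj.
rewrite inE => /exists_inP [d1 Fd1 /eqP ed1].
apply/forall_inP => e2; rewrite inE => /exists_inP [d2 Fd2 /eqP ed2].
apply/implyP => /eqP cE; apply/eqP/val_inj; rewrite ed1 ed2.
by rewrite (rb d1 d2) // -ed1 -ed2 !set_color_val cE.
Qed.

End SetColor.

(** * Block colorings *)

Definition crossing (T : finType) (B : eqType) (block : T -> B) (A : {set T}) :=
  [exists u in A, exists v in A, block u != block v].

Lemma crossingPn (T : finType) (B : eqType) (block : T -> B) (A : {set T}) :
  reflect {in A &, forall u v, block u = block v} (~~ crossing block A).
Proof.
rewrite negb_exists_in; apply: (iffP forall_inP) => [eqb u v Au Av|eqb u Au].
  have := eqb u Au; rewrite negb_exists_in => /forall_inP /(_ v Av).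
  by rewrite negbK => /eqP.
rewrite negb_exists_in; apply/forall_inP => v Av.
by rewrite negbK; apply/eqP/eqb.
Qed.

Lemma crossing_imset (S T : finType) (B : eqType) (block : T -> B) (f : S -> T)
    (A : {set S}) u v :
  u \in A -> v \in A -> block (f u) != block (f v) -> crossing block (f @: A).
Proof.
move=> Au Av uv; apply/exists_inP; exists (f u); first exact: imset_f.
by apply/exists_inP; exists (f v); first exact: imset_f.
Qed.

(** Adjacent vertices share a hyperedge, hence a block, so the vertices in a
    given block are closed under adjacency. *)
Lemma connected_one_block r (F : hypergraph r) (T : finType) (B : eqType)
    (block : T -> B) (f : F -> T) :
  connected F -> (forall e, e \in edges F -> ~~ crossing block (f @: e)) ->
  forall u v, block (f u) = block (f v).
Proof.
move=> /forallP conF flat u v.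
have cl : closed (@adjacent r F) [pred w | block (f u) == block (f w)].
  move=> w1 w2 /exists_inP [e Fe /andP [e1 e2]]; rewrite !inE.
  by rewrite (crossingPn _ _ (flat e Fe) (f w1) (f w2)) ?imset_f.
have /forallP /(_ v) := conF u; move=> /(closed_connect cl).
by rewrite !inE eqxx => /esym /eqP.
Qed.

Section BlockColoring.
Variables (r t n p : nat) (B : eqType) (block : 'I_p -> B) (pos : 'I_p -> 'I_n).
Hypothesis pos_inj : forall u v, block u = block v -> pos u = pos v -> u = v.
Variable c : edge_coloring t (complete_hypergraph r n).

(** The pair [(block, pos)] gives each vertex its block and its place in a copy
    of the complete hypergraph of order [n].  The inner default is never
    reached: inside a block [pos] is injective, so [pos @: val e] is a
    hyperedge. *)
Definition block_coloring : edge_coloring t.+1 (complete_hypergraph r p) :=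
  [ffun e : edge (complete_hypergraph r p) =>
     if crossing block (val e) then ord_max
     else odflt ord_max
       (omap (widen_ord (leqnSn t))
          (set_color c (pos @: (val e : {set 'I_p}) : {set 'I_n})))].

Section Copy.
Variables (F : hypergraph r) (f : {ffun F -> complete_hypergraph r p}).
Hypothesis f_emb : embedding f.

Lemma set_color_crossing e : e \in edges F -> crossing block (f @: e) ->
  set_color block_coloring (f @: e) = Some ord_max.
Proof.
move=> Fe cr; pose fe : edge (complete_hypergraph r p) :=
  exist _ (f @: e) (embedding_edge f_emb Fe).
by rewrite -[f @: e]/(val fe) set_color_val ffunE /= cr.
Qed.

Definition pos_copy : {ffun F -> complete_hypergraph r n} :=
  [ffun v => pos (f v) : complete_hypergraph r n].

Lemma pos_copy_imset (e : {set F}) : pos_copy @: e = pos @: (f @: e).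
Proof. by rewrite -imset_comp; apply: eq_imset => v; rewrite ffunE. Qed.

Lemma set_color_flat e : e \in edges F -> ~~ crossing block (f @: e) ->
  exists2 i : 'I_t, set_color c (pos_copy @: e) = Some i
    & set_color block_coloring (f @: e) = Some (widen_ord (leqnSn t) i).
Proof.
move=> Fe cr; pose fe : edge (complete_hypergraph r p) :=
  exist _ (f @: e) (embedding_edge f_emb Fe).
have Ge : pos_copy @: e \in edges (complete_hypergraph r n).
  rewrite inE pos_copy_imset card_in_imset; last first.
    by move=> u v Au Av; apply: pos_inj; apply: (crossingPn _ _ cr).
  by rewrite (edges_uniform (embedding_edge f_emb Fe)).
pose ge : edge (complete_hypergraph r n) := exist _ (pos_copy @: e) Ge.
have cE : set_color c (pos_copy @: e) = Some (c ge) by exact: set_color_val ge.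
exists (c ge) => //.
rewrite -[f @: e]/(val fe) set_color_val ffunE /= (negbTE cr).
by rewrite -pos_copy_imset cE.
Qed.

Lemma pos_copy_embedding :
  (forall u v, block (f u) = block (f v)) -> embedding pos_copy.
Proof.
move=> flat; have inj : injective pos_copy.
  by move=> u v; rewrite !ffunE => /(pos_inj (flat u v)) /(embedding_inj f_emb).
apply/andP; split; first exact/injectiveP.
by apply/forall_inP => e Fe; rewrite inE card_imset // (edges_uniform Fe).
Qed.

Lemma one_block_flat (e : {set F}) :
  (forall u v, block (f u) = block (f v)) -> ~~ crossing block (f @: e).
Proof. by move=> flat; apply/crossingPn => _ _ /imsetP [u _ ->] /imsetP [v _ ->]. Qed.

(** Crossing hyperedges have the new color, so no hyperedge of a copy in an old
    color crosses; by connectedness the copy lies in one block, where [pos] is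
    injective and carries the colors of [c]. *)
Lemma block_coloring_old (i : 'I_t) : connected F ->
  monochromatic block_coloring (widen_ord (leqnSn t) i) (copy_edges f) ->
  embedding pos_copy && monochromatic c i (copy_edges pos_copy).
Proof.
move=> conF /(monochromaticP _ f_emb) mono.
have flat e : e \in edges F -> ~~ crossing block (f @: e).
  move=> Fe; apply/negP => /(set_color_crossing Fe); rewrite mono // => -[ti].
  by have := ltn_ord i; rewrite ti ltnn.
have emb : embedding pos_copy.
  exact: pos_copy_embedding (connected_one_block conF flat).
rewrite emb; apply/(monochromaticP _ emb) => e Fe.
have [j -> ] := set_color_flat Fe (flat e Fe).
by rewrite mono // => -[ij]; congr Some; apply: val_inj.
Qed.

Lemma block_coloring_new e :
  monochromatic block_coloring ord_max (copy_edges f) ->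
  e \in edges F -> crossing block (f @: e).
Proof.
move=> /(monochromaticP _ f_emb) mono Fe; apply: contraT.
move=> /(set_color_flat Fe) [i _]; rewrite mono // => -[ti].
by have := ltn_ord i; rewrite -ti ltnn.
Qed.

End Copy.

(** The hyperedges on r + 1 vertices are the complements of single vertices.
    If two of the vertices lie in different blocks, at most one hyperedge does
    not cross, since removing a vertex leaves one block only when that vertex
    was alone outside it. So at least r > 1 hyperedges have the new color. *)
Lemma gallai_block_coloring : 1 < r -> gallai c -> gallai block_coloring.
Proof.
move=> r_gt1 gal; apply/existsP => -[f /andP [emb /(rainbowP _ emb) rb]].
have [/forallP flat|] := boolP [forall u, forall v, block (f u) == block (f v)].
  have {}flat u v : block (f u) = block (f v).
    by have /forallP /(_ v) /eqP := flat u.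
  have emb' := pos_copy_embedding emb flat.
  case/existsP: gal; exists (pos_copy f); rewrite emb' /=.
  apply/(rainbowP _ emb') => e1 e2 Fe1 Fe2.
  have [i1 -> E1] := set_color_flat emb Fe1 (one_block_flat e1 flat).
  have [i2 -> E2] := set_color_flat emb Fe2 (one_block_flat e2 flat).
  by move=> [i12]; apply: rb => //; rewrite E1 E2 i12.
rewrite negb_forall => /existsP [u]; rewrite negb_forall => /existsP [v uv].
have uNv : v != u by apply: contraNneq uv => ->.
(* A third vertex exists because [r.+1 > 2]. *)
have [w] : exists w, w \in ~: [set u; v].
  apply/card_gt0P; rewrite cardsCs setCK card_ord cards2 eq_sym uNv.
  by rewrite subn_gt0.
rewrite !inE negb_or => /andP [wu wv].
have edgeC (x : 'I_r.+1) : [set~ x] \in edges (complete_hypergraph r r.+1).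
  by rewrite inE cardsC1 card_ord.
have two_crossing x y : x != y -> crossing block (f @: [set~ x]) ->
    crossing block (f @: [set~ y]) -> False.
  move=> /negP xy crx cry; apply: xy.
  have /setP /(_ x) : [set~ x] = [set~ y].
    by apply: rb => //; rewrite !(set_color_crossing emb).
  by rewrite !inE eqxx => /esym /negbFE.
have crw : crossing block (f @: [set~ w]).
  by apply: (crossing_imset (u := u) (v := v)); rewrite ?inE // eq_sym.
(* The block of [w] differs from that of [u] or from that of [v]; removing the
   other one of [u] and [v] leaves a second crossing hyperedge. *)
have [wuE|wuE] := eqVneq (block (f w)) (block (f u)).
  apply: (two_crossing _ _ wu crw).
  by apply: (crossing_imset (u := w) (v := v)); rewrite ?inE // wuE.
apply: (two_crossing _ _ wv crw).
by apply: (crossing_imset (u := w) (v := u)); rewrite ?inE // eq_sym.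
Qed.

End BlockColoring.

(** * The lower bound *)

Lemma gallai_ramsey_arrow r t (H : 'I_t -> hypergraph r) :
  gallai_arrow H (gallai_ramsey H).
Proof. by rewrite /gallai_ramsey; case: ex_minnP. Qed.

Lemma lt_gallai_ramsey r t (H : 'I_t -> hypergraph r) m :
  m < gallai_ramsey H -> ~~ gallai_arrow H m.
Proof.
rewrite /gallai_ramsey; case: ex_minnP => q _ minq ltm.
by apply/negP => /minq; rewrite leqNgt ltm.
Qed.

(** Without vertices nothing nonempty embeds, and an edge coloring exists as
    soon as there is at least one color. *)
Lemma gallai_ramsey_gt0 r t (H : 'I_t.+1 -> hypergraph r) :
  (forall i, 0 < #|H i|) -> 0 < gallai_ramsey H.
Proof.
move=> H_gt0; case: posnP (gallai_ramsey_arrow H) => // -> /forallP arrow.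
have gal : gallai ([ffun=> ord0] : edge_coloring t.+1 (complete_hypergraph r 0)).
  by apply/existsP => -[f _]; case: (f ord0).
have /existsP [i /existsP [f _]] := implyP (arrow _) gal.
by have /card_gt0P [v _] := H_gt0 i; case: (f v).
Qed.

Lemma chromatic_number_gt0 r (F : hypergraph r) :
  1 < r -> 0 < #|F| -> 0 < chromatic_number F.
Proof.
move=> r_gt1 /card_gt0P [v _]; have [/existsP [c _] _] := chromatic_numberP F r_gt1.
by apply: leq_ltn_trans (ltn_ord (c v)).
Qed.

(** A coloring with an empty class can be recolored without the color of that
    class, so every class of a proper coloring with the least number of colors
    is nonempty. *)
Lemma min_class_gt0 r (F : hypergraph r) :
  1 < r -> 0 < #|F| -> 0 < min_class F.
Proof.
move=> r_gt1 F_gt0; have [[c [j [c_proper <-]]] _] := min_classP r_gt1 F_gt0.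
have [_] := chromatic_numberP F r_gt1.
move: c j c_proper; case: (chromatic_number F) => [|k] c j c_proper k_min.
  by case: j.
rewrite lt0n; apply/negP; rewrite cards_eq0 => /eqP class0.
have c_j v : j != c v.
  apply/eqP => jE; have : v \in c @^-1: [set j] by rewrite !inE -jE.
  by rewrite class0 inE.
suff /k_min : colorable F k by rewrite ltnn.
apply/existsP; exists [ffun v => sval (unlift_some (c_j v))].
apply/forall_inP => e Fe; apply/existsP => -[i /forall_inP ei].
have /forall_inP /(_ e Fe) /existsP := c_proper; apply; exists (lift j i).
apply/forall_inP => v ev; have /eqP := ei v ev; rewrite ffunE => <-.
by case: (unlift_some (c_j v)) => /= ? ->.
Qed.

(* The number of colors is t.+1; the last hypergraph is H ord_max and the
   family of the other ones is obtained by restriction to 'I_t. *)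
Theorem theorem5 (r t : nat) (r_ge2 : 2 <= r) (t_ge2 : 2 <= t.+1)
    (H : 'I_t.+1 -> hypergraph r)
    (H_nonempty : forall i, 0 < #|H i|)
    (H_connected : forall i, connected (H i))
    (H_ge : gallai_ramsey (fun i : 'I_t => H (widen_ord (leqnSn t) i))
            >= min_class (H ord_max)) :
  gallai_ramsey H
  >= (chromatic_number (H ord_max) - 1)
       * (gallai_ramsey (fun i : 'I_t => H (widen_ord (leqnSn t) i)) - 1)
     + min_class (H ord_max).
Proof.
have H'_nonempty (i : 'I_t) : 0 < #|H (widen_ord (leqnSn t) i)| by [].
have g_gt0 : 0 < gallai_ramsey (fun i : 'I_t => H (widen_ord (leqnSn t) i)).
  case: t t_ge2 H {H_connected H_ge} H_nonempty H'_nonempty => // t' *.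
  exact: gallai_ramsey_gt0.
move: (chromatic_number_gt0 r_ge2 (H_nonempty ord_max)).
have [_ minP] := min_classP r_ge2 (H_nonempty ord_max).
move: minP H_ge g_gt0 (lt_gallai_ramsey (H := fun i => H (widen_ord (leqnSn t) i))).
set g := gallai_ramsey _; set s := min_class _; set k := chromatic_number _.
case: g => // n; case: k => // k minP s_le _ notarrow _.
rewrite !subn1 /= leqNgt; apply/negP.
have := gallai_ramsey_arrow H; set p := gallai_ramsey H => /forallP arrow p_lt.
have /forallPn [c] := notarrow n (ltnSn n).
rewrite negb_imply => /andP [c_gallai c_nocopy].
(* If [n = 0] then [s <= 1], so that [p = 0]. *)
have n_gt0 (v : 'I_p) : 0 < n.
  case: n s_le p_lt {notarrow c c_gallai c_nocopy} => // s_le p_lt.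
  rewrite muln0 add0n in p_lt.
  by have := leq_trans (ltn_ord v) (leq_trans p_lt s_le : p <= 0).
have block_lt (v : 'I_p) : v %/ n < k.+1.
  rewrite ltn_divLR ?n_gt0 // mulSn addnC; apply: leq_trans (ltn_ord v) _.
  by rewrite -ltnS -addnS; apply: leq_trans p_lt _; rewrite leq_add2l.
pose block v : 'I_k.+1 := Ordinal (block_lt v).
pose pos (v : 'I_p) : 'I_n := Ordinal (ltn_pmod v (n_gt0 v)).
have pos_inj u v : block u = block v -> pos u = pos v -> u = v.
  move=> /(congr1 val) /= uv /(congr1 val) /= uv'; apply: val_inj.
  by rewrite /= (divn_eq u n) uv uv' -divn_eq.
have := arrow (block_coloring block pos c).
rewrite (gallai_block_coloring pos_inj r_ge2 c_gallai) /=.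
case/existsP => i; case: (unliftP ord_max i) => [j|] -> /existsP [f /andP [emb mono]].
  have jE : lift ord_max j = widen_ord (leqnSn t) j.
    by apply: val_inj; apply: lift_max.
  move: f emb mono; rewrite jE => f emb mono.
  case/existsP: c_nocopy; exists j; apply/existsP; exists (pos_copy pos f).
  exact: (block_coloring_old pos_inj emb).
have proper_block : Defs.proper ([ffun v => block (f v)] : {ffun H ord_max -> 'I_k.+1}).
  apply/forall_inP => e He; apply/existsP => -[b /forall_inP eb].
  have := block_coloring_new pos_inj emb mono He; apply/negP/crossingPn.
  move=> _ _ /imsetP [u eu ->] /imsetP [v ev ->].
  by have /eqP := eb u eu; have /eqP := eb v ev; rewrite !ffunE => -> ->.
have := minP _ ord_max proper_block; apply/negP; rewrite -ltnNge.
(* The last block lies in the interval from [k * n] to [p], of length below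
   [s]. *)
rewrite cardE -(size_map (fun v => val (f v))).
apply: (@leq_ltn_trans (size (iota (k * n) (p - k * n)))); last first.
  by rewrite size_iota ltn_psubLR // min_class_gt0.
apply: uniq_leq_size.
  rewrite map_inj_uniq ?enum_uniq // => u v /val_inj.
  exact: (embedding_inj emb).
move=> _ /mapP [v + ->].
rewrite mem_enum !inE ffunE => /eqP /(congr1 val) /= v_last.
have v_ge : k * n <= f v by rewrite -v_last leq_divM.
have v_lt : f v < p := ltn_ord (f v).
by rewrite mem_iota v_ge subnKC // (leq_trans v_ge) // ltnW.
Qed.
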